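(* Let $R$ and $S$ be unital rings. If $R$ is a $QB$-ring and $S$ is Morita equivalent to $R$, then $S$ is also a $QB$-ring.
   Context: Rings are associative. For elements $s,t$ of a unital ring $R$ write $s\perp t$ if $sRt=0$ and $tRs=0$. An element $u\in R$ is quasi-invertible, $u\in R_q^{-1}$, if there exist $c,d\in R$ with $(1-uc)\perp(1-du)$. A unital ring $R$ is a $QB$-ring if for all $a,b,x\in R$ with $xa+b=1$ there is $y\in R$ with $a+yb\in R_q^{-1}$. *)

(* Defs.v *)
From HB Require Import structures.
From mathcomp Require Import all_boot all_algebra.

Set Implicit Arguments.
Unset Strict Implicit.
Unset Printing Implicit Defensive.

Import GRing.Theory.
Local Open Scope ring_scope.

(* [pzRingType]: associative unital rings, not necessarily commutative and     *)
(* possibly zero.                                                             *)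

Definition ring_perp (R : pzRingType) (s t : R) : Prop :=
  (forall r : R, s * r * t = 0) /\ (forall r : R, t * r * s = 0).

Definition quasi_invertible (R : pzRingType) (u : R) : Prop :=
  exists c d : R, ring_perp (1 - u * c) (1 - d * u).

Definition QB_ring (R : pzRingType) : Prop :=
  forall a b x : R, x * a + b = 1 ->
    exists y : R, quasi_invertible (a + y * b).

(* Functors R-Mod -> S-Mod. Morphisms are compared pointwise, hence the       *)
(* compatibility field [fmap_ext]. Additivity is not assumed.                 *)
Record mod_functor (R S : pzRingType) := ModFunctor {
  fobj :> lmodType R -> lmodType S;
  fmap : forall M N : lmodType R, {linear M -> N} -> {linear fobj M -> fobj N};
  fmap_ext : forall (M N : lmodType R) (f g : {linear M -> N}),
    f =1 g -> fmap f =1 fmap g;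
  fmap_id : forall M : lmodType R,
    fmap (idfun : {linear M -> M}) =1 idfun;
  fmap_comp : forall (M N P : lmodType R)
      (g : {linear N -> P}) (f : {linear M -> N}),
    fmap (g \o f : {linear M -> P}) =1 fmap g \o fmap f
}.

Definition mod_functor_id (R : pzRingType) : mod_functor R R :=
  @ModFunctor R R (fun M => M) (fun M N f => f)
    (fun M N f g fg => fg) (fun M x => erefl) (fun M N P g f x => erefl).

Section Comp.
Variables (R S T : pzRingType) (G : mod_functor S T) (F : mod_functor R S).

Let compmap (M N : lmodType R) (f : {linear M -> N}) :
  {linear G (F M) -> G (F N)} := fmap G (fmap F f).

Fact compmap_ext (M N : lmodType R) (f g : {linear M -> N}) :
  f =1 g -> compmap f =1 compmap g.
Proof. by move=> fg; apply: fmap_ext; apply: fmap_ext. Qed.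

Fact compmap_id (M : lmodType R) :
  compmap (idfun : {linear M -> M}) =1 idfun.
Proof.
move=> x; rewrite -[RHS](@fmap_id _ _ G); apply: fmap_ext => {}x.
exact: fmap_id.
Qed.

Fact compmap_comp (M N P : lmodType R)
    (g : {linear N -> P}) (f : {linear M -> N}) :
  compmap (g \o f : {linear M -> P}) =1 compmap g \o compmap f.
Proof.
move=> x; rewrite /= -[RHS](@fmap_comp _ _ G); apply: fmap_ext => {}x.
exact: fmap_comp.
Qed.

Definition mod_functor_comp : mod_functor R T :=
  ModFunctor compmap_ext compmap_id compmap_comp.
End Comp.

Definition nat_isomorphic (R S : pzRingType) (F G : mod_functor R S) : Prop :=
  exists eta : forall M : lmodType R, {linear F M -> G M},
    (forall M : lmodType R, bijective (eta M)) /\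
    (forall (M N : lmodType R) (f : {linear M -> N}),
       eta N \o fmap F f =1 fmap G f \o eta M).

Definition morita_equivalent (R S : pzRingType) : Prop :=
  exists (F : mod_functor R S) (G : mod_functor S R),
    nat_isomorphic (mod_functor_comp G F) (mod_functor_id R) /\
    nat_isomorphic (mod_functor_comp F G) (mod_functor_id S).

(* Main.v *)
Require Import Defs.
From HB Require Import structures.
From mathcomp Require Import all_boot all_algebra boolp.
From Stdlib Require Ncring Ncring_tac.

Set Implicit Arguments.
Unset Strict Implicit.
Unset Printing Implicit Defensive.

Import GRing.Theory.
Local Open Scope ring_scope.

(* If F : R-Mod -> S-Mod is an equivalence with inverse G, the trace of F(R)  *)
(* in S is all of S, which yields a finite dual basis of G(S); hence S is     *)
(* isomorphic to a corner f M_n(R) f, where n may be taken to be a power of   *)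
(* 2. Corners inherit the QB property by completing an element a of the       *)
(* corner to a + (1 - f). For the step from A to M_2(A), row and column       *)
(* operations bring the matrix to the form                                    *)
(*    [ u1          q1 x p2 ]                                                 *)
(*    [ q2 y p1     u2      ]                                                 *)
(* with u1, u2 quasi-invertible, and q_i, p_i the left and right defect       *)
(* idempotents of u_i; since q_i A p_i = 0 the operations do not disturb u1   *)
(* and u2. It remains to correct the off-diagonal entries, which is possible  *)
(* because the skew corners q1 A p2 and q2 A p1 also satisfy the QB           *)
(* condition.                                                                 *)

(** The module-theoretic half needs only that [G] is full and faithful and that [G W] is isomorphic
    to [R^o] for some [W], here [F R^o]. Additivity of [G] follows ([fmap_addE]), [trace_full]
    expresses the unit of [S] through maps out of [W], and [G] turns this expression into a dual
    basis ([fmap_dual_basis]).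

    The ring-theoretic half is [block_QB]. Diagonal entries can only be made quasi-invertible, so
    clearing the other entries leaves a remainder between defects. By [defect_skew_QB] the QB
    condition of [A] passes to maps between defects of two quasi-invertibles, and
    [stably_qi_perturb] lifts the correction found there to the whole matrix. *)

Section NonCommutativeRing.
Variable A : pzRingType.

#[local] Instance pzRing_ops : @Ncring.Ring_ops A 0 1 (@GRing.add A)
  (@GRing.mul A) (fun x y => x - y) (@GRing.opp A) eq := {}.

#[local] Instance pzRing_ncring : Ncring.Ring (Ro := pzRing_ops).
Proof.
constructor; try by [move=> ? ? -> ? ? -> | move=> ? ? ->].
- exact: RelationClasses.eq_equivalence.
- exact: add0r.
- exact: addrC.
- exact: addrA.
- exact: mul1r.
- exact: mulr1.
- exact: mulrA.
- exact: mulrDl.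
- by move=> x y z; exact: mulrDr.
- by move=> x y; reflexivity.
- by move=> x; exact: subrr.
Qed.
End NonCommutativeRing.
#[local] Existing Instance pzRing_ops.
#[local] Existing Instance pzRing_ncring.
Ltac ncring := solve [Ncring_tac.non_commutative_ring].

(** * Quasi-inverses, defects and skew corners *)

Section QuasiInverses.
Variable A : pzRingType.
Implicit Types a b c d e k p q r u v w x y z s t : A.

(** Certificates for equations modulo relations: [z] is an explicit combination of the available
    relations, [ncring] checks the free identity [x - y = z], and the relations make [z] vanish. *)
Lemma eq_lincomb x y z : x - y = z -> z = 0 -> x = y.
Proof. by move=> <- /eqP; rewrite subr_eq0 => /eqP. Qed.

Definition qinv u v := [/\ u * v * u = u, v * u * v = v &
  ring_perp (1 - u * v) (1 - v * u)].

(** With [v = c + d - c * u * d] both defects factor, as [(1 - u c)(1 - u d)] and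
    [(1 - c u)(1 - d u)], so orthogonality is inherited and [u v u = u]. Passing to [v u v] gives
    the second identity without changing [u v] or [v u]. *)
Lemma quasi_invertibleP u : quasi_invertible u -> exists v, qinv u v.
Proof.
move=> [c [d [cd dc]]].
pose v := c + d - c * u * d.
have uvE : 1 - u * v = (1 - u * c) * (1 - u * d) by rewrite /v; ncring.
have vuE : 1 - v * u = (1 - c * u) * (1 - d * u) by rewrite /v; ncring.
have uvu : u * v * u = u.
  apply: (@eq_lincomb _ _ (- ((1 - u * c) * u * (1 - d * u)))).
    by rewrite /v; ncring.
  by rewrite cd oppr0.
exists (v * u * v); split; rewrite ?mulrA ?uvu //.
  apply: (@eq_lincomb _ _ (v * (u * v * u - u) * v * u * v
    + v * (u * v * u - u) * v)); first by ncring.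
  by rewrite uvu subrr !(mulr0, mul0r, addr0).
rewrite -2!(mulrA v) uvu uvE vuE; split=> r.
  by have := cd ((1 - u * d) * r * (1 - c * u)); rewrite !mulrA.
have -> : (1 - c * u) * (1 - d * u) * r * ((1 - u * c) * (1 - u * d)) =
  (1 - c * u) * ((1 - d * u) * r * (1 - u * c)) * (1 - u * d).
  by rewrite !mulrA.
by rewrite dc mulr0 mul0r.
Qed.

Lemma quasi_invertible_mull e e' u : e' * e = 1 -> e * e' = 1 ->
  quasi_invertible u -> quasi_invertible (e * u).
Proof.
move=> e'e ee' [c [d [cd dc]]]; exists (c * e'), (d * e').
have -> : 1 - e * u * (c * e') = e * (1 - u * c) * e'.
  by rewrite -{1}ee'; ncring.
have -> : d * e' * (e * u) = d * u by rewrite !mulrA -(mulrA d) e'e mulr1.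
split=> r.
  by have /(congr1 ( *%R e)) := cd (e' * r); rewrite mulr0 !mulrA.
by have := dc (r * e); rewrite !mulrA => ->; rewrite mul0r.
Qed.

Lemma quasi_invertible_mulr e e' u : e' * e = 1 -> e * e' = 1 ->
  quasi_invertible u -> quasi_invertible (u * e).
Proof.
move=> e'e ee' [c [d [cd dc]]]; exists (e' * c), (e' * d).
have -> : 1 - e' * d * (u * e) = e' * (1 - d * u) * e.
  by rewrite -{1}e'e; ncring.
have -> : u * e * (e' * c) = u * c by rewrite !mulrA -(mulrA u) ee' mulr1.
split=> r.
  by have := cd (r * e'); rewrite !mulrA => ->; rewrite mul0r.
by have /(congr1 ( *%R e')) := dc (e * r); rewrite mulr0 !mulrA.
Qed.

(* For idempotents [p] and [q], the skew corner [q * A * p] is thought of as  *)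
(* the maps from [p] to [q].                                                  *)
Definition skew_quasi_invertible p q u := exists v,
  v = p * v * q /\ ring_perp (q - u * v) (p - v * u).

(** Here [p - x * a] stands for [b]: it is the solution of [x a + b = p], with [p] acting as the
    identity. *)
Definition skew_QB p q := forall a x, a = q * a * p -> x = p * x * q ->
  exists y, y = q * y * p /\ skew_quasi_invertible p q (a + y * (p - x * a)).

Lemma skew_compress p q w k z : p * p = p -> q * q = q ->
    ring_perp (1 - w * k) (1 - k * w) ->
    q * w * p = q * w -> p * k * (1 - q) = p * (1 - k * w) * z ->
  skew_quasi_invertible p q (q * w).
Proof.
move=> pp qq [wk kw] qwp pkz; exists (p * k * q); split.
  by rewrite !mulrA pp -!mulrA qq.
have -> : q - q * w * (p * k * q) = q * (1 - w * k) * q.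
  by rewrite !mulrA qwp -{1}qq; ncring.
have -> : p - p * k * q * (q * w) = p * (1 - k * w) * (p + z * w * p).
  apply: (@eq_lincomb _ _ ((p - p * p) + p * k * (q - q * q) * w
    + p * k * (q * w * p - q * w) +
    (p * k * (1 - q) - p * (1 - k * w) * z) * w * p)); first by ncring.
  by rewrite pp qq qwp pkz !subrr !(mulr0, mul0r, addr0).
split=> r.
  have -> : q * (1 - w * k) * q * r * (p * (1 - k * w) * (p + z * w * p)) =
    q * ((1 - w * k) * (q * r * p) * (1 - k * w)) * (p + z * w * p) by ncring.
  by rewrite wk mulr0 mul0r.
have -> : p * (1 - k * w) * (p + z * w * p) * r * (q * (1 - w * k) * q) =
  p * ((1 - k * w) * ((p + z * w * p) * r * q) * (1 - w * k)) * q by ncring.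
by rewrite kw mulr0 mul0r.
Qed.

Lemma QB_qinv a x : QB_ring A ->
  exists y, exists k, qinv (a + y * (1 - x * a)) k.
Proof.
move=> qbA; have [|y /quasi_invertibleP[k ?]] := qbA a (1 - x * a) x.
  by rewrite subrKC.
by exists y, k.
Qed.

Lemma corner_QB f : QB_ring A -> f * f = f -> skew_QB f f.
Proof.
move=> qbA ff a x aE xE.
have fa : f * a = a by rewrite aE !mulrA ff.
have af : a * f = a by rewrite aE -!mulrA ff.
have xf : x * f = x by rewrite xE -!mulrA ff.
have fx : f * x = x by rewrite xE !mulrA ff.
have [y [k []]] := QB_qinv (a + 1 - f) (x + 1 - f) qbA.
have -> : 1 - (x + 1 - f) * (a + 1 - f) = f - x * a.
  apply: (@eq_lincomb _ _ ((f * a - a) + (x * f - x) + (f - f * f))).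
    by ncring.
  by rewrite fa xf ff !subrr !addr0.
set w := _ + _ => _ _ wk.
exists (f * y * f); split; first by rewrite !mulrA ff -!mulrA ff.
have wE : a + f * y * f * (f - x * a) = f * w.
  apply: (@eq_lincomb _ _ ((a - f * a) + f * y * ((f * f - f) -
    (f * x - x) * a) + (f * f - f))); first by rewrite /w; ncring.
  by rewrite fa ff fx !subrr !(mul0r, mulr0, subr0, addr0).
have wf : w * f = w - (1 - f).
  apply: (@eq_lincomb _ _ ((a * f - a) + (f - f * f) + y * ((f * f - f)
    - x * (a * f - a)))); first by rewrite /w; ncring.
  by rewrite af ff !subrr !(mul0r, mulr0, subr0, addr0).
(* Since [w (1 - f) = 1 - f], the element [f k (1 - f)] equals [f (1 - k w)] times [-(1 - f)]. *)
rewrite wE; apply: (@skew_compress _ _ w k (- (1 - f)))=> //.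
  by rewrite -mulrA wf !mulrBr mulr1 ff subrr subr0.
apply: (@eq_lincomb _ _ (f * k * (w * f - (w - (1 - f))) + (f - f * f))).
  by ncring.
by rewrite wf ff !subrr mulr0 addr0.
Qed.

(* [u1 * u2] kills the defect [1 - v2 * u2] and misses [1 - u1 * v1], so it   *)
(* completes a map [a] between these defects to [u1 * u2 + a], to which the   *)
(* QB condition of [A] applies; orthogonality of the defects of each [ui]     *)
(* kills the cross terms on compressing the result back to the skew corner.   *)
Lemma defect_skew_QB u1 v1 u2 v2 : QB_ring A -> qinv u1 v1 -> qinv u2 v2 ->
  skew_QB (1 - v2 * u2) (1 - u1 * v1).
Proof.
move=> qbA [uvu1 vuv1 [perp1 _]] [uvu2 vuv2 [_ perp2]] a x.
set p := 1 - v2 * u2; set q := 1 - u1 * v1 => aE xE.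
have pp : p * p = p.
  by apply: (@eq_lincomb _ _ ((v2 * u2 * v2 - v2) * u2));
    [rewrite /p; ncring | rewrite vuv2 subrr mul0r].
have qq : q * q = q.
  by apply: (@eq_lincomb _ _ ((u1 * v1 * u1 - u1) * v1));
    [rewrite /q; ncring | rewrite uvu1 subrr mul0r].
have qu1 : q * u1 = 0 by rewrite mulrBl mul1r uvu1 subrr.
have v1q : v1 * q = 0 by rewrite mulrBr mulr1 mulrA vuv1 subrr.
have pv2 : p * v2 = 0 by rewrite mulrBl mul1r vuv2 subrr.
have p1v1 : (1 - v1 * u1) * v1 = 0 by rewrite mulrBl mul1r vuv1 subrr.
have v1a : v1 * a = 0 by rewrite aE !mulrA v1q !mul0r.
have av2 : a * v2 = 0 by rewrite aE -!mulrA pv2 !mulr0.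
have xu1 : x * u1 = 0 by rewrite xE -!mulrA qu1 !mulr0.
have qa : q * a = a by rewrite aE !mulrA qq.
have ap : a * p = a by rewrite aE -!mulrA pp.
have px : p * x = x by rewrite xE !mulrA pp.
have [y [k []]] := QB_qinv (u1 * u2 + a) (v2 * v1 + x) qbA.
have -> : 1 - (v2 * v1 + x) * (u1 * u2 + a) =
    p - x * a + v2 * (1 - v1 * u1) * u2.
  apply: (@eq_lincomb _ _ (- (v2 * (v1 * a)) - x * u1 * u2)).
    by rewrite /p; ncring.
  by rewrite v1a xu1 mul0r mulr0 oppr0 addr0.
set w := _ + _ => _ _ wk.
exists (q * y * p); split; first by rewrite !mulrA qq -!mulrA pp.
have wE : a + q * y * p * (p - x * a) = q * w.
  apply: (@eq_lincomb _ _ (- (q * u1 * u2) + (a - q * a)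
    + q * y * ((p * p - p) - (p * x - x) * a)
    - q * (y * v2) * (1 - v1 * u1) * u2)); first by rewrite /w; ncring.
  by rewrite qu1 qa pp px perp1 !subrr !(mul0r, mulr0, subr0, addr0, oppr0).
(* After [p k], the element [w v2 v1] acts as [u1 v1 = 1 - q]: [p A (1 - u2 v2) = 0] removes
   [u2 v2], and [p v2], [a v2] and [(1 - v1 u1) v1] vanish. *)
rewrite wE; apply: (@skew_compress _ _ w k (- (v2 * v1))) => //.
  apply: (@eq_lincomb _ _ ((q * w - (a + q * y * p * (p - x * a))) * (p - 1)
    + (a * p - a) + q * y * p * ((p * p - p) - x * (a * p - a)))).
    by ncring.
  by rewrite wE ap pp !subrr !(mul0r, mulr0, subr0, addr0).
apply: (@eq_lincomb _ _ (p * (k * u1) * (1 - u2 * v2) * v1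
   - p * k * (a * v2) * v1
   - p * k * y * (p * v2) * v1 + p * k * y * x * (a * v2) * v1
   - p * k * y * v2 * ((1 - v1 * u1) * v1)
   + p * (k * y * v2 * (1 - v1 * u1)) * (1 - u2 * v2) * v1
   + p * v2 * v1)).
  by rewrite /w /q; ncring.
by rewrite pv2 av2 p1v1 !perp2 !(mul0r, mulr0, subr0, addr0, oppr0).
Qed.

Definition unimodular a b := exists x z, x * a + z * b = 1.
Definition stably_qi a b := exists y, quasi_invertible (a + y * b).

(** Correct [n] to [w] inside the skew corner, using [p x q]. The same correction applied to [u + n]
    gives [u + w] up to the left factor [1 - y x u v], a unit because [v y = 0] makes [y x u v]
    square to zero. The defects of [u + w] against [v + w'] are those of [w] in the skew corner. *)
Lemma stably_qi_perturb u v n b :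
    u * v * u = u -> v * u * v = v ->
    skew_QB (1 - v * u) (1 - u * v) ->
    n = (1 - u * v) * n * (1 - v * u) ->
  unimodular (u + n) b -> stably_qi (u + n) b.
Proof.
move=> uvu vuv.
set p := 1 - v * u; set q := 1 - u * v => sQB nE [x [z xz]].
have pp : p * p = p.
  by apply: (@eq_lincomb _ _ ((v * u * v - v) * u));
    [rewrite /p; ncring | rewrite vuv subrr mul0r].
have qq : q * q = q.
  by apply: (@eq_lincomb _ _ ((u * v * u - u) * v));
    [rewrite /q; ncring | rewrite uvu subrr mul0r].
have qu : q * u = 0 by rewrite mulrBl mul1r uvu subrr.
have up : u * p = 0 by rewrite mulrBr mulr1 mulrA uvu subrr.
have vq : v * q = 0 by rewrite mulrBr mulr1 mulrA vuv subrr.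
have pv : p * v = 0 by rewrite mulrBl mul1r vuv subrr.
have np : n * p = n by rewrite nE -!mulrA pp.
have qn : q * n = n by rewrite nE !mulrA qq.
have [|y [yE [w']]] := sQB n (p * x * q) nE.
  by rewrite -!mulrA qq !mulrA pp.
set w := n + _ => -[w'E [ww' w'w]].
have yp : y * p = y by rewrite yE -!mulrA pp.
have qy : q * y = y by rewrite yE !mulrA qq.
have vy : v * y = 0 by rewrite yE !mulrA vq !mul0r.
have wp : w * p = w.
  apply: (@eq_lincomb _ _ ((n * p - n) + y * ((p * p - p)
     - p * x * q * (n * p - n)))); first by rewrite /w; ncring.
  by rewrite np pp !subrr !(mul0r, mulr0, subr0, addr0).
have qw : q * w = w.
  apply: (@eq_lincomb _ _ ((q * n - n) + (q * y - y) * (p - p * x * q * n))).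
    by rewrite /w; ncring.
  by rewrite qn qy !subrr !(mul0r, mulr0, subr0, addr0).
have wv : w * v = 0 by rewrite -wp -mulrA pv mulr0.
have vw : v * w = 0 by rewrite -qw mulrA vq mul0r.
have uw' : u * w' = 0 by rewrite w'E !mulrA up !mul0r.
have w'u : w' * u = 0 by rewrite w'E -!mulrA qu !mulr0.
exists (y * z).
have -> : u + n + y * z * b = (1 - y * x * u * v) * (u + w).
  apply: (@eq_lincomb _ _ (y * (x * (u + n) + z * b - 1)
     - (y * p - y) + (y * p - y) * x * q * n + y * x * (q * n - n)
     + y * x * (u * v * u - u) + y * x * u * (v * w))).
    by rewrite /w; ncring.
  rewrite xz yp qn uvu vw.
  by rewrite !subrr !(mul0r, mulr0, subr0, addr0).
have ee : y * x * u * v * (y * x * u * v) = 0.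
  by rewrite -!mulrA (mulrA v) vy mul0r !mulr0.
apply: (@quasi_invertible_mull _ (1 + y * x * u * v)).
- apply: (@eq_lincomb _ _ (- (y * x * u * v * (y * x * u * v)))).
    by ncring.
  by rewrite ee oppr0.
- apply: (@eq_lincomb _ _ (- (y * x * u * v * (y * x * u * v)))).
    by ncring.
  by rewrite ee oppr0.
exists (v + w'), (v + w').
have -> : 1 - (u + w) * (v + w') = q - w * w'.
  apply: (@eq_lincomb _ _ (- (u * w') - w * v)); first by rewrite /q; ncring.
  by rewrite uw' wv oppr0 addr0.
have -> : 1 - (v + w') * (u + w) = p - w' * w.
  apply: (@eq_lincomb _ _ (- (v * w) - w' * u)); first by rewrite /p; ncring.
  by rewrite w'u vw oppr0 addr0.
by split.
Qed.

Lemma row_reduction e e' y a b : e' * e = 1 -> e * e' = 1 ->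
    (unimodular (e * a + y * b) b -> stably_qi (e * a + y * b) b) ->
  unimodular a b -> stably_qi a b.
Proof.
move=> e'e ee' reduced [x [z xz]]; case: reduced => [|y' qi].
  exists (x * e'), (z - x * e' * y).
  apply: (@eq_lincomb _ _ (x * (e' * e - 1) * a + (x * a + z * b - 1))).
    by ncring.
  by rewrite e'e xz !subrr !(mul0r, mulr0, addr0).
exists (e' * (y + y')).
have -> : a + e' * (y + y') * b = e' * (e * a + y * b + y' * b).
  apply: (@eq_lincomb _ _ (- (e' * e - 1) * a)); first by ncring.
  by rewrite e'e subrr oppr0 mul0r.
exact: (quasi_invertible_mull ee').
Qed.

Lemma col_reduction e e' a b : e' * e = 1 -> e * e' = 1 ->
    (unimodular (a * e) (b * e) -> stably_qi (a * e) (b * e)) ->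
  unimodular a b -> stably_qi a b.
Proof.
move=> e'e ee' reduced [x [z xz]]; case: reduced => [|y qi].
  exists (e' * x), (e' * z).
  by rewrite -!mulrA -mulrDr !mulrA -mulrDl xz mul1r.
exists y.
have -> : a + y * b = (a * e + y * (b * e)) * e'.
  by rewrite mulrA -mulrDl -mulrA ee' mulr1.
exact: (quasi_invertible_mulr ee').
Qed.
End QuasiInverses.

(** * Two-by-two block matrices *)

(** Skew defects carry [q] or [p] as a factor on either side, so that [perp_sandwich] can use
    [q A p = 0]. *)
Lemma skew_defectE (A : pzRingType) (p q a x y z : A) : a = q * a * p ->
    y = q * y * p -> z = p * z * q ->
  forall w, w = a + y * (p - x * a) -> exists s s' t t',
  [/\ q - w * z = q * s, q - w * z = s' * q, p - z * w = p * t &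
      p - z * w = t' * p].
Proof.
move=> aE yE zE w wE.
exists (1 - (a * p + y * p * (p - x * a)) * z), (1 - w * p * z).
exists (1 - z * q * w), (1 - z * (q * a + y - y * x * q * a)); split.
- by rewrite wE {1}aE {1}yE; ncring.
- by rewrite {1}zE; ncring.
- by rewrite {1}zE; ncring.
- rewrite wE; apply: (@eq_lincomb _ _ _
    (z * (q * a * p - a) - z * y * x * (q * a * p - a))); first by ncring.
  by rewrite -aE subrr !mulr0 subr0.
Qed.

Lemma perp_sandwich (A : pzRingType) (p q s t s' t' r : A) :
  (forall r, q * r * p = 0) -> s = s' * q -> t = p * t' -> s * r * t = 0.
Proof.
by move=> qp -> ->; rewrite !mulrA -2!(mulrA s') qp mulr0 mul0r.
Qed.

Section BlockMatrices.
Variables (R : pzRingType) (n : nat).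
Local Notation A := 'M[R]_n.
Local Notation T := 'M[R]_(n + n).
Implicit Types (a b c d p q u v x y z : A) (r : T).

Definition block a b c d : T := block_mx a b c d.

Lemma blockE r : exists a b c d, r = block a b c d.
Proof.
exists (ulsubmx r), (ursubmx r), (dlsubmx r), (drsubmx r).
by rewrite /block submxK.
Qed.

Lemma blockM a b c d a' b' c' d' : block a b c d * block a' b' c' d' =
  block (a * a' + b * c') (a * b' + b * d') (c * a' + d * c') (c * b' + d * d').
Proof. exact: mulmx_block. Qed.

Lemma blockD a b c d a' b' c' d' : block a b c d + block a' b' c' d' =
  block (a + a') (b + b') (c + c') (d + d').
Proof. exact: add_block_mx. Qed.

Lemma blockN a b c d : - block a b c d = block (- a) (- b) (- c) (- d).
Proof. exact: opp_block_mx. Qed.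

Lemma block1 : 1 = block 1 0 0 1.
Proof. exact: scalar_mx_block. Qed.

Lemma block0 : 0 = block 0 0 0 0.
Proof. by rewrite /block block_mx0. Qed.

Lemma block_inj a b c d a' b' c' d' : block a b c d = block a' b' c' d' ->
  [/\ a = a', b = b', c = c' & d = d'].
Proof. exact: eq_block_mx. Qed.

Definition blockSE := (blockM, blockD, blockN, mul0r, mulr0, mul1r, mulr1,
  add0r, addr0, oppr0).

Lemma block_upperK y : block 1 (- y) 0 1 * block 1 y 0 1 = 1.
Proof. by rewrite block1 !blockSE subrr. Qed.

Lemma block_lowerK y : block 1 0 (- y) 1 * block 1 0 y 1 = 1.
Proof. by rewrite block1 !blockSE addNr. Qed.

(** Diagonal entries vanish because [q_i A p_i = 0], so the problem splits into two independent skew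
    conditions. These give the off-diagonal zeros of the orthogonality relations; the diagonal ones
    come again from [q_i A p_i = 0] and [p_i A q_i = 0]. *)
Lemma antidiag_skew_QB p1 q1 p2 q2 : ring_perp q1 p1 -> ring_perp q2 p2 ->
    skew_QB p1 q2 -> skew_QB p2 q1 ->
  skew_QB (block p1 0 0 p2) (block q1 0 0 q2).
Proof.
move=> [qp1 pq1] [qp2 pq2] sQB1 sQB2 a x.
have [a11 [a12 [a21 [a22 ->]]]] := blockE a.
have [x11 [x12 [x21 [x22 ->]]]] := blockE x.
rewrite !blockSE => /block_inj[-> a12E a21E ->] /block_inj[-> x12E x21E ->].
rewrite qp1 pq1 qp2 pq2.
have [y21 [y21E [z12 [z12E yz1]]]] := sQB1 _ _ a21E x12E.
have [y12 [y12E [z21 [z21E yz2]]]] := sQB2 _ _ a12E x21E.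
exists (block 0 y12 y21 0); rewrite !blockSE -y12E -y21E; split=> //.
exists (block 0 z12 z21 0); rewrite !blockSE -z12E -z21E; split=> //.
have [s1 [s1' [t1 [t1' [s1E s1E' t1E t1E']]]]] :=
  skew_defectE a12E y12E z21E (erefl (a12 + y12 * (p2 - x21 * a12))).
have [s2 [s2' [t2 [t2' [s2E s2E' t2E t2E']]]]] :=
  skew_defectE a21E y21E z12E (erefl (a21 + y21 * (p1 - x12 * a21))).
move: yz1 yz2 => [yz1 zy1] [yz2 zy2].
split=> r; have [r11 [r12 [r21 [r22 ->]]]] := blockE r;
  rewrite !blockSE ?yz1 ?yz2 ?zy1 ?zy2 block0.
  by congr block; [exact: perp_sandwich qp1 s1E' t2E
                  | exact: perp_sandwich qp2 s2E' t1E].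
by congr block; [exact: perp_sandwich pq1 t2E' s1E
                | exact: perp_sandwich pq2 t1E' s2E].
Qed.

Lemma block_upperVK y : block 1 y 0 1 * block 1 (- y) 0 1 = 1.
Proof. by rewrite block1 !blockSE addNr. Qed.

Lemma block_lowerVK y : block 1 0 y 1 * block 1 0 (- y) 1 = 1.
Proof. by rewrite block1 !blockSE subrr. Qed.

(** Clearing the off-diagonal entries against [u2] changes the corner [u1] only by elements of
    [q1 A p1 = 0]. What remains beside the diagonal is antidiagonal between defects, as
    [stably_qi_perturb] requires. *)
Lemma qinv_block_stably_qi u1 v1 u2 v2 x y (b : T) : QB_ring A ->
    qinv u1 v1 -> qinv u2 v2 ->
    let a := block u1 ((1 - u1 * v1) * x) (y * (1 - v1 * u1)) u2 in
  unimodular a b -> stably_qi a b.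
Proof.
move=> qbA u1P u2P /=.
have [uvu1 vuv1 perp1] := u1P; have [uvu2 vuv2 perp2] := u2P.
set q1 := 1 - u1 * v1; set p1 := 1 - v1 * u1.
set q2 := 1 - u2 * v2; set p2 := 1 - v2 * u2.
apply: (row_reduction (y := 0) (block_upperK (- (q1 * x * v2)))
  (block_upperVK (- (q1 * x * v2)))).
apply: (col_reduction (block_lowerK (- (v2 * y * p1)))
  (block_lowerVK (- (v2 * y * p1)))).
rewrite mul0r addr0 !blockSE.
have pv2 : p2 * v2 = 0 by rewrite mulrBl mul1r vuv2 subrr.
have -> : q1 * x + - (q1 * x * v2) * u2 = q1 * x * p2 by rewrite /p2; ncring.
have -> : u1 + - (q1 * x * v2) * (y * p1) + q1 * x * p2 * - (v2 * y * p1) = u1.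
  apply: (@eq_lincomb _ _ _ (- (q1 * (x * v2 * y) * p1)
    - q1 * x * (p2 * v2) * (y * p1))); first by ncring.
  by rewrite perp1.1 pv2 mulr0 mul0r oppr0 addr0.
have -> : y * p1 + u2 * - (v2 * y * p1) = q2 * y * p1 by rewrite /q2; ncring.
have -> : block u1 (q1 * x * p2) (q2 * y * p1) u2 =
    block u1 0 0 u2 + block 0 (q1 * x * p2) (q2 * y * p1) 0.
  by rewrite !blockSE.
have p1E : block p1 0 0 p2 = 1 - block v1 0 0 v2 * block u1 0 0 u2.
  by rewrite block1 !blockSE.
have q1E : block q1 0 0 q2 = 1 - block u1 0 0 u2 * block v1 0 0 v2.
  by rewrite block1 !blockSE.
apply: (stably_qi_perturb (v := block v1 0 0 v2)).
- by rewrite !blockSE uvu1 uvu2.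
- by rewrite !blockSE vuv1 vuv2.
- rewrite -p1E -q1E; apply: antidiag_skew_QB => //; exact: defect_skew_QB.
rewrite -p1E -q1E !blockSE.
have pp2 : p2 * p2 = p2 by rewrite {2}/p2 mulrBr mulr1 mulrA pv2 mul0r subr0.
have qq2 : q2 * q2 = q2.
  by rewrite {2}/q2 mulrBr mulr1 mulrA mulrBl mul1r uvu2 subrr mul0r subr0.
have pp1 : p1 * p1 = p1.
  by rewrite {2}/p1 mulrBr mulr1 mulrA mulrBl mul1r vuv1 subrr mul0r subr0.
have qq1 : q1 * q1 = q1.
  by rewrite {2}/q1 mulrBr mulr1 mulrA mulrBl mul1r uvu1 subrr mul0r subr0.
by rewrite !mulrA qq1 qq2 -!mulrA pp1 pp2.
Qed.

Lemma corner_qinv_stably_qi u v x y z (b : T) : QB_ring A -> qinv u v ->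
  unimodular (block u x y z) b -> stably_qi (block u x y z) b.
Proof.
move=> qbA uP; have [uvu vuv perp1] := uP.
apply: (col_reduction (block_upperK (- (v * x))) (block_upperVK (- (v * x)))).
set b' := b * _; rewrite !blockSE.
set q := 1 - u * v; set p := 1 - v * u.
have -> : u * - (v * x) + x = q * x by rewrite /q; ncring.
set z' := _ + z.
move=> abU; have [X [Z]] := abU.
have [x11 [x12 [x21 [x22 ->]]]] := blockE X.
have [c11 [c12 [c21 [c22 ZbE]]]] := blockE (Z * b').
rewrite ZbE block1 !blockSE => /block_inj[_ _ _ xc].
have vq : v * q = 0 by rewrite mulrBr mulr1 mulrA vuv subrr.
have qu : q * u = 0 by rewrite mulrBl mul1r uvu subrr.
have qq : q * q = q.
  by rewrite {2}/q mulrBr mulr1 mulrA qu mul0r subr0.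
(* The lower right entry of the unimodularity relation, read as a relation for [z']. *)
have [|t /quasi_invertibleP[v2 u2P]] := qbA z' (x21 * (q * x) + c22) x22.
  by rewrite -xc addrCA addrA.
pose m := y + t * c21.
(* The term [t x21 q] supplies what the lower right entry lacks and kills [u]; the term [- m v] cuts
   the lower left entry down to [m p] and kills [q x]. *)
pose s := t * x21 * q - m * v.
move: abU; apply: (row_reduction (y := block 0 0 0 t * Z)
  (block_lowerK s) (block_lowerVK s)).
rewrite -mulrA ZbE !blockSE.
have -> : s * u + y + t * c21 = m * p.
  apply: (@eq_lincomb _ _ _ (t * x21 * (q * u))).
    by rewrite /s /p /m; ncring.
  by rewrite qu mulr0.
have -> : s * (q * x) + z' + t * c22 = z' + t * (x21 * (q * x) + c22).
  apply: (@eq_lincomb _ _ _ (t * x21 * (q * q - q) * x - m * (v * q) * x)).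
    by rewrite /s; ncring.
  by rewrite qq vq subrr !(mulr0, mul0r) subrr.
exact: qinv_block_stably_qi uP u2P.
Qed.

Lemma block_QB : QB_ring A -> QB_ring T.
Proof.
move=> qbA a b x xab.
suff : stably_qi a b by [].
have : unimodular a b by exists x, 1; rewrite mul1r.
move: xab.
have [a11 [a12 [a21 [a22 ->]]]] := blockE a.
have [x11 [x12 [x21 [x22 ->]]]] := blockE x.
have [b11 [b12 [b21 [b22 ->]]]] := blockE b.
rewrite block1 !blockSE => /block_inj[xb _ _ _].
(* The upper left entry of [x a + b = 1]; adding [t x12] times the second row and [t] times the
   first row of [b] realises this correction of [a11]. *)
have [|t /quasi_invertibleP[v uP]] := qbA a11 (x12 * a21 + b11) x11.
  by rewrite addrA.
apply: (row_reduction (y := block t 0 0 0)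
  (block_upperK (t * x12)) (block_upperVK (t * x12))).
rewrite !blockSE.
have -> : a11 + t * x12 * a21 + t * b11 = a11 + t * (x12 * a21 + b11).
  by ncring.
exact: corner_qinv_stably_qi uP.
Qed.

End BlockMatrices.

(** * Descent to corners and matrix rings of size a power of two *)

(** The hypotheses identify [A] with the corner of [T] at the idempotent [phi 1], which may differ
    from [1]; [corner_QB] is then pulled back. *)
Lemma corner_embedding_QB (A T : pzRingType) (phi : A -> T) :
    {morph phi : x y / x - y} -> {morph phi : x y / x * y} ->
    (forall x, phi x = 0 -> x = 0) ->
    (forall m, m = phi 1 * m * phi 1 -> exists x, phi x = m) ->
  QB_ring T -> QB_ring A.
Proof.
move=> phiB phiM phi_eq0 phi_onto qbT a b x xab.
have phi1 z : phi z = phi 1 * phi z * phi 1 by rewrite -!phiM mul1r mulr1.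
have [|y [/phi_onto[y0 <-] [k [/phi_onto[k0 <-] [perp1 perp2]]]]] :=
  corner_QB (f := phi 1) qbT _ (phi1 a) (phi1 x).
  by rewrite -phiM mulr1.
have phi0 : phi 0 = 0 by rewrite -{1}(subrr 0) phiB subrr.
have phiN z : phi (- z) = - phi z by rewrite -sub0r phiB phi0 sub0r.
have phiD z t : phi (z + t) = phi z + phi t.
  by rewrite -{1}(opprK t) phiB phiN opprK.
move: perp1 perp2; rewrite -!(phiM, phiB, phiD).
have -> : 1 - x * a = b by rewrite -xab addrC addKr.
move=> perp1 perp2; exists y0, k0, k0.
by split=> r; apply: phi_eq0; rewrite !phiM ?perp1 ?perp2.
Qed.

Lemma QB_matrix_pow2 (R : pzRingType) k : QB_ring R -> QB_ring 'M[R]_(2 ^ k).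
Proof.
move=> qbR; elim: k => [|k IHk]; last first.
  by rewrite expnS mul2n -addnn; exact: block_QB.
apply: (@corner_embedding_QB _ R (fun m : 'M[R]_1 => m 0 0)) qbR => /=.
- by move=> x y; rewrite !mxE.
- by move=> x y; rewrite mxE big_ord1.
- by move=> x x0; apply/matrixP=> i j; rewrite !ord1 x0 mxE.
- by move=> m _; exists m%:M; rewrite mxE eqxx mulr1n.
Qed.

(** * Linear maps and trace submodules *)

Section LinearMaps.
Variable R : pzRingType.
Implicit Types M N P : lmodType R.

Definition mk_linear M N (f : M -> N) (fL : linear f) : {linear M -> N} :=
  HB.pack f (GRing.isLinear.Build R M N *:%R f fL).

Fact scaler_linear M (x : M) : linear (fun r : R^o => (r : R) *: x).
Proof. by move=> a r s; rewrite scalerDl scalerA. Qed.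
Definition scaler_map M (x : M) : {linear R^o -> M} :=
  mk_linear (scaler_linear x).

Fact zero_linear M N : linear (fun _ : M => 0 : N).
Proof. by move=> a x y; rewrite scaler0 addr0. Qed.
Definition zero_map M N : {linear M -> N} := mk_linear (@zero_linear M N).

Lemma linear_inverse M N (f : {linear M -> N}) : bijective f ->
  exists g : {linear N -> M}, cancel f g /\ cancel g f.
Proof.
case=> g fg gf.
have gL : linear g by move=> a x y; apply: (can_inj fg); rewrite linearP !gf.
by exists (mk_linear gL).
Qed.
End LinearMaps.

Section TraceSubmodule.
Variables (S : pzRingType) (W N : lmodType S).

Definition trace_pred : {pred N} := fun x =>
  `[< exists l : seq ({linear W -> N} * W), x = \sum_(p <- l) p.1 p.2 >].

Fact trace_closed : submod_closed trace_pred.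
Proof.
split; first by apply/asboolP; exists [::]; rewrite big_nil.
move=> a x y /asboolP[l ->] /asboolP[l' ->]; apply/asboolP.
exists ([seq (p.1, a *: p.2) | p <- l] ++ l').
rewrite big_cat big_map scaler_sumr; congr (_ + _).
by apply: eq_bigr => p _; rewrite linearZ.
Qed.
HB.instance Definition _ :=
  GRing.isSubmodClosed.Build S N trace_pred trace_closed.

Record trace := Trace { trace_val : N ; _ : trace_val \in trace_pred }.
HB.instance Definition _ := [isSub for trace_val].
HB.instance Definition _ := [Choice of trace by <:].
HB.instance Definition _ := [SubChoice_isSubLmodule of trace by <:].

Lemma trace_incl (h : {linear W -> N}) x : h x \in trace_pred.
Proof. by apply/asboolP; exists [:: (h, x)]; rewrite big_seq1. Qed.

Lemma trace_corestrict (h : {linear W -> N}) :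
  exists h' : {linear W -> trace}, forall x, \val (h' x) = h x.
Proof.
pose g x := Trace (trace_incl h x).
have gL : linear g by move=> a x y; apply: val_inj; rewrite /= linearP.
by exists (mk_linear gL).
Qed.
End TraceSubmodule.

(** * Full and faithful functors: additivity, trace and dual basis *)

Section FullFaithful.
Variables (R S : pzRingType) (G : mod_functor S R).
Hypothesis G_faithful : forall (M N : lmodType S) (f g : {linear M -> N}),
  fmap G f =1 fmap G g -> f =1 g.
Hypothesis G_full : forall (M N : lmodType S) (h : {linear G M -> G N}),
  exists f : {linear M -> N}, fmap G f =1 h.
Implicit Types M N P : lmodType S.

Lemma fmap_compE M N P (h : {linear M -> P}) (g : {linear N -> P})
    (f : {linear M -> N}) : (forall x, h x = g (f x)) ->
  forall z, fmap G h z = fmap G g (fmap G f z).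
Proof. by move=> hE z; rewrite -[RHS](@fmap_comp _ _ G); exact: fmap_ext. Qed.

Lemma fmap_idE M (h : {linear M -> M}) : (forall x, h x = x) ->
  forall z, fmap G h z = z.
Proof. by move=> hE z; rewrite -[RHS](@fmap_id _ _ G); exact: fmap_ext. Qed.

(** By fullness the zero endomorphism of [G N] is the image of some [k]; since zero composed with
    [k] is zero, [G] sends zero to zero. *)
Lemma fmap_zeroE M N (h : {linear M -> N}) : (forall x, h x = 0) ->
  forall z, fmap G h z = 0.
Proof.
move=> h0 z; have [k kE] := G_full (zero_map (G N) (G N)).
have e0 y : fmap G (zero_map N N) y = 0.
  rewrite (@fmap_compE _ _ _ _ (zero_map N N) k) // kE; exact: raddf0.
by rewrite (@fmap_compE _ _ _ _ (zero_map N N) h) ?e0.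
Qed.

Lemma fmap_eq0 M N (h : {linear M -> N}) : (forall z, fmap G h z = 0) ->
  forall x, h x = 0.
Proof.
move=> h0; apply: (G_faithful (g := zero_map M N)) => z.
by rewrite h0 fmap_zeroE.
Qed.

(** A sum factors through the biproduct [N * N], which [G] preserves: the defect [d] of the
    splitting of [G NN] lifts to some [k], and faithfulness makes both components of [k] zero. *)
Lemma fmap_addE M N (f g h : {linear M -> N}) :
  (forall x, h x = f x + g x) -> forall z, fmap G h z = fmap G f z + fmap G g z.
Proof.
move=> hE z; pose NN : lmodType S := (N * N)%type.
have p1L : linear (fun w : NN => w.1) by [].
have p2L : linear (fun w : NN => w.2) by [].
have i1L : linear (fun x : N => (x, 0) : NN).
  by move=> a x y; congr pair; rewrite /= scaler0 addr0.
have i2L : linear (fun x : N => (0, x) : NN).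
  by move=> a x y; congr pair; rewrite /= scaler0 addr0.
have sL : linear (fun w : NN => w.1 + w.2).
  by move=> a x y; rewrite scalerDr addrACA.
have fgL : linear (fun x : M => (f x, g x) : NN).
  by move=> a x y; rewrite !linearP.
pose p1 := mk_linear p1L; pose p2 := mk_linear p2L.
pose i1 := mk_linear i1L; pose i2 := mk_linear i2L.
pose s := mk_linear sL; pose fg := mk_linear fgL.
have p1i1 w : fmap G p1 (fmap G i1 w) = w.
  by rewrite -(@fmap_compE _ _ _ (p1 \o i1 : {linear _ -> _})) // fmap_idE.
have p2i2 w : fmap G p2 (fmap G i2 w) = w.
  by rewrite -(@fmap_compE _ _ _ (p2 \o i2 : {linear _ -> _})) // fmap_idE.
have p1i2 w : fmap G p1 (fmap G i2 w) = 0.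
  by rewrite -(@fmap_compE _ _ _ (p1 \o i2 : {linear _ -> _})) // fmap_zeroE.
have p2i1 w : fmap G p2 (fmap G i1 w) = 0.
  by rewrite -(@fmap_compE _ _ _ (p2 \o i1 : {linear _ -> _})) // fmap_zeroE.
pose d : {linear G NN -> G NN} :=
  (idfun \- (fmap G i1 \o fmap G p1)) \- (fmap G i2 \o fmap G p2).
have [k kE] := G_full d.
have k0 x : k x = 0.
  rewrite [k x]surjective_pairing.
  have -> : (k x).1 = 0.
    apply: (fmap_eq0 (h := p1 \o k : {linear _ -> _})) => w.
    rewrite (@fmap_compE _ _ _ _ p1 k) // kE /d /= !linearB /=.
    by rewrite p1i1 p1i2 subrr subr0.
  have -> // : (k x).2 = 0.
  apply: (fmap_eq0 (h := p2 \o k : {linear _ -> _})) => w.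
  rewrite (@fmap_compE _ _ _ _ p2 k) // kE /d /= !linearB /=.
  by rewrite p2i1 p2i2 subr0 subrr.
have splitE w : w = fmap G i1 (fmap G p1 w) + fmap G i2 (fmap G p2 w).
  have /eqP := kE w; rewrite fmap_zeroE // eq_sym /d /=.
  by rewrite -addrA -opprD subr_eq0 => /eqP.
rewrite (@fmap_compE _ _ _ h s fg) // (splitE (fmap G fg z)) linearD.
congr (_ + _).
  rewrite -(@fmap_compE _ _ _ (s \o i1 : {linear _ -> _})) //.
  rewrite fmap_idE; last by move=> x; rewrite /= addr0.
  by rewrite -(@fmap_compE _ _ _ f).
rewrite -(@fmap_compE _ _ _ (s \o i2 : {linear _ -> _})) //.
rewrite fmap_idE; last by move=> x; rewrite /= add0r.
by rewrite -(@fmap_compE _ _ _ g).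
Qed.

Lemma fmap_sumE M N (l : seq {linear M -> N}) (h : {linear M -> N}) :
    (forall x, h x = \sum_(f <- l) f x) ->
  forall z, fmap G h z = \sum_(f <- l) fmap G f z.
Proof.
elim: l h => [|f l IHl] h hE z.
  by rewrite big_nil fmap_zeroE // => x; rewrite hE big_nil.
have gL : linear (fun x => \sum_(f <- l) f x).
  move=> a x y; rewrite scaler_sumr -big_split.
  by apply: eq_bigr => g _; rewrite linearP.
rewrite big_cons -(IHl (mk_linear gL)) //.
by apply: fmap_addE => x; rewrite hE big_cons.
Qed.

Variables (W : lmodType S) (eta : {linear G W -> R^o}).
Hypothesis eta_bij : bijective eta.

Lemma fmap_generator : exists w0 : G W, eta w0 = 1 /\
  (forall w, w = (eta w : R) *: w0).
Proof.
have [g [eta_g g_eta]] := linear_inverse eta_bij.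
exists (g 1); split=> // w.
by rewrite -linearZ -[LHS]eta_g; congr (g _); rewrite /GRing.scale /= mulr1.
Qed.

Lemma fmap_represent M (x : G M) :
  exists h : {linear W -> M}, forall z, fmap G h z = (eta z : R) *: x.
Proof. exact: (G_full (scaler_map x \o eta)). Qed.

(* The image under [G] of the inclusion of the trace submodule is bijective,  *)
(* since every map out of [W] factors through it and [G W] is free of rank    *)
(* one.                                                                       *)
Lemma trace_full N (x : N) : x \in @trace_pred S W N.
Proof.
have [w0 [eta_w0 w0E]] := fmap_generator.
pose i : {linear trace W N -> N} := \val.
have i_inj y : fmap G i y = 0 -> y = 0.
  move=> iy; have [h hE] := fmap_represent y.
  have h0 z : h z = 0.
    apply: val_inj; rewrite raddf0.
    apply: (fmap_eq0 (h := i \o h : {linear _ -> _})) => {}z.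
    by rewrite (@fmap_compE _ _ _ _ i h) // hE linearZ /= iy scaler0.
  by rewrite -[y]scale1r -eta_w0 -hE fmap_zeroE.
have i_surj y : exists z, fmap G i z = y.
  have [h hE] := fmap_represent y; have [h' h'E] := trace_corestrict h.
  exists (fmap G h' w0).
  by rewrite -(@fmap_compE _ _ _ h) ?hE ?eta_w0 ?scale1r // => z; rewrite -h'E.
have i_bij : bijective (fmap G i).
  pose g y := sval (cid (i_surj y)).
  have gK : cancel g (fmap G i) by move=> y; rewrite /g; case: cid.
  exists g => // y; apply/eqP; rewrite -subr_eq0; apply/eqP/i_inj.
  by rewrite linearB /= gK subrr.
have [g [ig gi]] := linear_inverse i_bij; have [k kE] := G_full g.
have <- : i (k x) = x.
  apply: (G_faithful (f := i \o k) (g := idfun)) => z.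
  by rewrite (@fmap_compE _ _ _ _ i k) // kE gi fmap_idE.
exact: valP (k x).
Qed.

(** Writing [1] as a sum of values [p.1 p.2] writes the identity of [S^o] as a sum of maps through
    [W]. Applying [G] factors the identity of [G S^o] through copies of [G W], free on [w0]. *)
Lemma fmap_dual_basis : exists l : seq ({linear G S^o -> R^o} * G S^o),
  forall z, z = \sum_(p <- l) (p.1 z : R) *: p.2.
Proof.
have /asboolP[l lE] := trace_full (1 : S^o).
have [w0 [_ w0E]] := fmap_generator.
exists [seq (eta \o fmap G (scaler_map p.2) : {linear _ -> _}, fmap G p.1 w0)
  | p <- l].
move=> z; rewrite big_map /=.
rewrite -[LHS](fmap_idE (h := idfun)) //.
rewrite (@fmap_sumE _ _ [seq (p.1 \o scaler_map p.2 : {linear S^o -> S^o})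
    | p : {linear W -> S^o} * W <- l]).
  rewrite big_map; apply: eq_bigr => p _.
  rewrite (@fmap_compE _ _ _ _ p.1 (scaler_map p.2)) //.
  by rewrite {1}[fmap G _ z]w0E linearZ.
move=> x; rewrite big_map /= -[LHS]mulr1 lE.
by rewrite mulr_sumr; apply: eq_bigr => p _; rewrite linearZ.
Qed.
End FullFaithful.

(** * [S] as a corner of a matrix ring over [R] *)

Section DualBasisCorner.
Variables (R S : pzRingType) (G : mod_functor S R).
Hypothesis G_faithful : forall (M N : lmodType S) (f g : {linear M -> N}),
  fmap G f =1 fmap G g -> f =1 g.
Hypothesis G_full : forall (M N : lmodType S) (h : {linear G M -> G N}),
  exists f : {linear M -> N}, fmap G f =1 h.
Local Notation P := (G S^o).
Variables (n : nat) (alpha : 'I_n -> {linear P -> R^o}) (b : 'I_n -> P).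
Hypothesis dual_basis : forall z, z = \sum_i (alpha i z : R) *: b i.

(** Row [i] holds coordinates of the image of [b i] under [G] of right multiplication by [s]. Right
    multiplication by [s * t] is that by [s] followed by that by [t], so the row convention
    preserves products. *)
Definition corner_mx (s : S) : 'M[R]_n :=
  \matrix_(i, j) alpha j (fmap G (scaler_map (s : S^o)) (b i)).

Lemma dual_basis_QB : QB_ring 'M[R]_n -> QB_ring S.
Proof.
apply: (@corner_embedding_QB _ _ corner_mx) => [s t|s t|s s0|m mE].
- apply/matrixP=> i j; rewrite !mxE; apply/eqP.
  rewrite eq_sym subr_eq -linearD; apply/eqP; congr (alpha j _).
  apply: (fmap_addE G_faithful G_full) => x.
  by rewrite /= /GRing.scale /= mulrBr subrK.
- apply/matrixP=> i k; rewrite mxE [RHS]mxE.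
  rewrite (@fmap_compE _ _ G _ _ _ _
    (scaler_map (t : S^o)) (scaler_map (s : S^o))); last first.
    by move=> x; rewrite /= /GRing.scale /= mulrA.
  rewrite {1}[fmap G (scaler_map (s : S^o)) _]dual_basis !linear_sum.
  by apply: eq_bigr => j _; rewrite !mxE !linearZ.
- rewrite -[s]mul1r.
  apply: (fmap_eq0 G_faithful G_full (h := scaler_map (s : S^o))) => z.
  rewrite [z]dual_basis linear_sum big1 // => i _.
  rewrite linearZ /= [fmap G _ _]dual_basis big1 ?scaler0 // => j _.
  by have /matrixP/(_ i j) := s0; rewrite !mxE => ->; rewrite scale0r.
(* A matrix of the corner acts on [P] in the coordinates [alpha]; by fullness the action comes from
   an endomorphism [k] of [S^o], which is right multiplication by [k 1]. *)
have hL : linear (fun z : P => \sum_i \sum_j (alpha i z * m i j : R) *: b j).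
  move=> a x y; rewrite scaler_sumr -big_split; apply: eq_bigr => i _.
  rewrite scaler_sumr -big_split; apply: eq_bigr => j _.
  by rewrite linearP /= mulrDl scalerDl scalerA mulrA.
have [k kE] := G_full (mk_linear hL).
exists (k 1); rewrite [RHS]mE; apply/matrixP=> i j.
rewrite !mxE (_ : fmap G _ _ = fmap G k (b i)); last first.
  by apply: fmap_ext => x; rewrite /= -linearZ /GRing.scale /= mulr1.
rewrite kE /= linear_sum.
transitivity (\sum_i0 \sum_j0 alpha i0 (b i) * m i0 j0 * alpha j (b j0)).
  apply: eq_bigr => i0 _; rewrite linear_sum; apply: eq_bigr => j0 _.
  by rewrite linearZ.
rewrite exchange_big; apply: eq_bigr => k' _.
rewrite !mxE mulr_suml; apply: eq_bigr => i' _; rewrite !mxE.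
have id1 (z : P) : fmap G (scaler_map (1 : S^o)) z = z.
  by apply: fmap_idE => x; rewrite /= /GRing.scale /= mulr1.
by rewrite !id1.
Qed.
End DualBasisCorner.

(** * Equivalences and the conclusion *)

Section Equivalence.
Variables (R S : pzRingType) (F : mod_functor R S) (G : mod_functor S R).

Lemma left_inverse_faithful :
    nat_isomorphic (mod_functor_comp F G) (mod_functor_id S) ->
  forall (M N : lmodType S) (f g : {linear M -> N}),
  fmap G f =1 fmap G g -> f =1 g.
Proof.
case=> eps [eps_bij epsE] M N f g fg x.
have [e _ eK] := eps_bij M; rewrite -(eK x).
have /= <- := epsE _ _ f (e x); have /= <- := epsE _ _ g (e x).
by rewrite (@fmap_ext _ _ F _ _ (fmap G f) (fmap G g) fg).
Qed.
End Equivalence.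

(** Conjugating [F h] by [eps] gives [f] with [F (G f) = F h], by naturality; [F] is faithful
    because [G F] is isomorphic to the identity. *)
Lemma inverse_full (R S : pzRingType) (F : mod_functor R S)
    (G : mod_functor S R) :
    nat_isomorphic (mod_functor_comp G F) (mod_functor_id R) ->
    nat_isomorphic (mod_functor_comp F G) (mod_functor_id S) ->
  forall (M N : lmodType S) (h : {linear G M -> G N}),
  exists f : {linear M -> N}, fmap G f =1 h.
Proof.
move=> GF [eps [eps_bij epsE]] M N h.
have [e [eK Ke]] := linear_inverse (eps_bij M).
exists (eps N \o fmap F h \o e : {linear _ -> _}).
apply: (left_inverse_faithful GF) => z.
apply: (bij_inj (eps_bij N)).
have /= -> := epsE _ _ (eps N \o fmap F h \o e : {linear M -> N}) z.
by rewrite eK.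
Qed.

Theorem corollary6p6 (R S : pzRingType) :
  QB_ring R -> morita_equivalent R S -> QB_ring S.
Proof.
move=> qbR [F [G [GF FG]]].
have G_faithful := left_inverse_faithful FG.
have G_full := inverse_full GF FG.
have [eta [eta_bij _]] := GF.
have [l lE] := fmap_dual_basis G_faithful G_full (eta_bij R^o).
have := @QB_matrix_pow2 R (size l) qbR.
have := ltnW (ltn_expl (size l) (isT : (1 < 2)%N)).
move: (2 ^ size l)%N => n le_ln qbM.
(* The dual basis is padded with zero pairs from [size l] to [2 ^ size l], a size that
   [QB_matrix_pow2] covers. *)
pose p0 : {linear G S^o -> R^o} * G S^o := (zero_map _ _, 0).
pose l' := l ++ nseq (n - size l) p0.
apply: (dual_basis_QB G_faithful G_full (n := n)
  (alpha := fun i => (nth p0 l' i).1) (b := fun i => (nth p0 l' i).2)) => // z.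
have pad m : \sum_(p <- nseq m p0) (p.1 z : R) *: p.2 = 0.
  by elim: m => [|m IHm] /=; rewrite ?big_nil // big_cons IHm scale0r addr0.
have <- : size l' = n by rewrite size_cat size_nseq subnKC.
rewrite -(big_mkord xpredT
  (fun i => ((nth p0 l' i).1 z : R) *: (nth p0 l' i).2)).
rewrite -(big_nth p0 xpredT (fun p => (p.1 z : R) *: p.2)) big_cat -lE.
by rewrite /= pad addr0.
Qed.
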